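(* Let $k\ge1$ and let $f:D\to\Lambda\times\mathbb{R}^u\times\mathbb{R}^s$ be a $C^{k+1}$ map satisfying the covering conditions, the rate conditions of order $k$ and the backward cone conditions (so that $W^{cs}=\{(\lambda,w^{cs}(\lambda,y),y):\lambda\in\Lambda,y\in\overline B_s(R)\}$ for a function $w^{cs}:\Lambda\times\overline B_s(R)\to\overline B_u(R)$). Let $M\in(0,L)$ and $\xi=\inf_{z\in D}m[\partial f_x/\partial x(P(z))]-\frac1M\sup_{z\in D}\|\partial f_x/\partial(\lambda,y)(z)\|$, $\mu=\sup_{z\in D}\{\|\partial f_{(\lambda,y)}/\partial(\lambda,y)(z)\|+M\|\partial f_{(\lambda,y)}/\partial x(z)\|\}$. If $\xi/\mu>1$, then $w^{cs}$ is Lipschitz with constant $M$.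
   Context: $c,u,s$ positive integers, $\Lambda=(\mathbb{R}/\mathbb{Z})^c$, $R_\Lambda=\tfrac12$; points are ''in the same chart'' if their $\lambda$-components have lifts to $\mathbb{R}^c$ at distance $\le R_\Lambda$; differences, norms, cones, derivatives and Lipschitz constants are computed in such lifts; $\overline B_c(\lambda,R_\Lambda)$ closed ball about a lift of $\lambda$. $B_n(R),\overline B_n(R)$ open/closed balls at $0$; Euclidean norms. $0<R<R_\Lambda/2$, $D=\Lambda\times\overline B_u(R)\times\overline B_s(R)$, $z=(\lambda,x,y)$, projections $\pi_\lambda,\pi_x,\pi_y,\pi_{(\lambda,x)},\pi_{(\lambda,y)}$, $f=(f_\lambda,f_x,f_y)$. $m(A)=\max\{c:\|Av\|\ge c\|v\|\}$, $m(\mathbf A)=\inf_{A\in\mathbf A}m(A)$; $[\partial g/\partial w(U)]$ = matrices with $(i,j)$ entry in $[\inf_U\partial g_i/\partial w_j,\sup_U\partial g_i/\partial w_j]$; $P(z)=\{w\in D:\|\pi_\lambda w-\pi_\lambda z\|\le R_\Lambda/2\}$. Fix $L\in(2R/R_\Lambda,1)$; constants $\mu_{s,1}=\sup_{D}\{\|\partial_y f_y\|+\frac1L\|\partial_{(\lambda,x)}f_y\|\}$, $\mu_{s,2}=\sup_D\{\|\partial_yf_y\|+L\|\partial_yf_{(\lambda,x)}\|\}$, $\xi_{u,1}=\inf_D\{m(\partial_xf_x)-\frac1L\|\partial_{(\lambda,y)}f_x\|\}$, $\xi_{u,1,P}=\inf_{z\in D}m[\partial_xf_x(P(z))]-\frac1L\sup_D\|\partial_{(\lambda,y)}f_x\|$,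 $\xi_{u,2}=\inf_D\{m(\partial_xf_x)-L\|\partial_xf_{(\lambda,y)}\|\}$, $\mu_{cs,1}=\sup_D\{\|\partial_{(\lambda,y)}f_{(\lambda,y)}\|+L\|\partial_xf_{(\lambda,y)}\|\}$, $\mu_{cs,2}=\sup_D\{\|\partial_{(\lambda,y)}f_{(\lambda,y)}\|+\frac1L\|\partial_{(\lambda,y)}f_x\|\}$, $\xi_{cu,1}=\inf_D\{m(\partial_{(\lambda,x)}f_{(\lambda,x)})-L\|\partial_yf_{(\lambda,x)}\|\}$, $\xi_{cu,1,P}=\inf_{z\in D}m[\partial_{(\lambda,x)}f_{(\lambda,x)}(P(z))]-L\sup_D\|\partial_yf_{(\lambda,x)}\|$, $\xi_{cu,2}=\inf_D\{m(\partial_{(\lambda,x)}f_{(\lambda,x)})-\frac1L\|\partial_{(\lambda,x)}f_y\|\}$. Rate conditions of order $k$: all $\xi$'s positive; $\mu_{s,1}<1<\xi_{u,1,P}$; $\mu_{cs,1}<\xi_{u,1,P}$; $\mu_{s,1}<\xi_{cu,1,P}$; for $1\le j\le k$: $\mu_{cs,1}^{j+1}<\xi_{u,2}$, $\mu_{s,2}<\xi_{cu,1}^{j+1}$; $\mu_{cs,2}<\xi_{u,1}$; $\mu_{s,1}<\xi_{cu,2}$. Cones $J_s(z,M)=\{\|(\lambda,x)-\pi_{(\lambda,x)}z\|\le M\|y-\pi_yz\|\}$, $J_u(z,M)=\{\|(\lambda,y)-\pi_{(\lambda,y)}z\|\le M\|x-\pi_xz\|\}$. $W^{cs}=\{z:f^n(z)\in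 D$ for all $n\ge0\}$. Backward cone conditions: if $z_1,z_2,f(z_1),f(z_2)\in D$ and $f(z_1)\in J_s(f(z_2),1/L)$ then $z_1\in J_s(z_2,1/L)$. Covering conditions: with $D_\lambda=\overline B_c(\lambda,R_\Lambda)\times\overline B_u(R)\times\overline B_s(R)$, $D^+_\lambda=\overline B_c(\lambda,R_\Lambda)\times\overline B_u(R)\times\partial B_s(R)$, $D^-_\lambda=\overline B_c(\lambda,R_\Lambda)\times\partial B_u(R)\times B_s(R)$: for each $z\in D$ there exist $\lambda^*$, a homotopy $h:[0,1]\times U\to B_c(\lambda^*,R_\Lambda)\times\mathbb{R}^u\times\mathbb{R}^s$ ($U=J_u(z,1/L)\cap D$) and linear $A$ with $h_0=f|_U$, $h_\alpha(U\cap D^-_{\pi_\lambda z})\cap D_{\lambda^*}=\emptyset$, $h_\alpha(U)\cap D^+_{\lambda^*}=\emptyset$ for all $\alpha$, $h_1(\lambda,x,y)=(\lambda^*,Ax,0)$, $A(\partial B_u(R))\subset\mathbb{R}^u\setminus\overline B_u(R)$. *)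

(* Defs.v *)
From mathcomp Require Import all_boot all_order all_algebra.
From mathcomp Require Import all_classical all_reals all_analysis.
Set Implicit Arguments. Unset Strict Implicit. Unset Printing Implicit Defensive.
Import Order.TTheory GRing.Theory Num.Theory.
Import numFieldNormedType.Exports.
Local Open Scope classical_set_scope.
Local Open Scope ring_scope.

Section Defs.
Variable R : realType.
Variables c u s : nat.
(* Points of (a lift of) D live in R^c x R^u x R^s, flattened as 'rV_(c+u+s)
   = 'rV_((c+u)+s):  z = row_mx (row_mx lambda x) y. *)
Notation N := (c + u + s)%N.
Notation V := 'rV[R]_N.

Definition enorm n (v : 'rV[R]_n) : R := Num.sqrt (\sum_i v 0 i ^+ 2).

Definition lam (z : V) : 'rV[R]_c := lsubmx (lsubmx z).
Definition xc  (z : V) : 'rV[R]_u := rsubmx (lsubmx z).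
Definition yc  (z : V) : 'rV[R]_s := rsubmx z.
Definition lamx (z : V) : 'rV[R]_(c + u) := lsubmx z.
Definition lamy (z : V) : 'rV[R]_(c + s) := row_mx (lam z) (yc z).

(* lattice vectors Z^c x {0} x {0}: deck transformations of the torus lift *)
Definition latt (d : V) : Prop :=
  forall i : 'I_N, if (i < c)%N then d 0 i \is a Num.int else d 0 i == 0.

(* the lift Dl = R^c x closed ball_u(Rad) x closed ball_s(Rad) of D *)
Definition inD (Rad : R) (z : V) : Prop := enorm (xc z) <= Rad /\ enorm (yc z) <= Rad.

Definition Il : pred 'I_N := fun i => (i < c)%N.
Definition Ix : pred 'I_N := fun i => (c <= i)%N && (i < c + u)%N.
Definition Iy : pred 'I_N := fun i => (c + u <= i)%N.
Definition Ilx : pred 'I_N := fun i => (i < c + u)%N.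
Definition Ily : pred 'I_N := fun i => ~~ Ix i.

Definition proj (P : pred 'I_N) (v : V) : V := \row_i (if P i then v 0 i else 0).
Definition suppin (Q : pred 'I_N) (v : V) : Prop := forall i, ~~ Q i -> v 0 i = 0.
(* A v for the column vector v (stored as a row) *)
Definition app (A : 'M[R]_N) (v : V) : V := v *m A^T.

(* operator norm of the block of A with rows P and columns Q *)
Definition opn (A : 'M[R]_N) (P Q : pred 'I_N) : R :=
  sup [set enorm (proj P (app A v)) | v in [set v | suppin Q v /\ enorm v <= 1]].
(* m(A) = max{ c : ||A v|| >= c ||v|| } for the block of A with rows P, cols Q *)
Definition mco (A : 'M[R]_N) (P Q : pred 'I_N) : R :=
  sup [set k : R | forall v, suppin Q v -> k * enorm v <= enorm (proj P (app A v))].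

Definition pd (g : V -> R) (j : 'I_N) : V -> R := fun z => derive g z (delta_mx 0 j).
Definition iterpd (l : seq 'I_N) (g : V -> R) : V -> R := foldr (fun j h => pd h j) g l.
Definition Cm (m : nat) (U : set V) (g : V -> R) : Prop :=
  forall l : seq 'I_N, (size l <= m)%N ->
    (forall z, U z -> {for z, continuous (iterpd l g)}) /\
    ((size l < m)%N -> forall j z, U z -> derivable (iterpd l g) z (delta_mx 0 j)).

Definition jac (F : V -> V) (z : V) : 'M[R]_N := \matrix_(i, j) pd (fun w => F w 0 i) j z.

Definition supD (Rad : R) (F : V -> V) (q : 'M[R]_N -> R) : R :=
  sup [set q (jac F z) | z in inD Rad].
Definition infD (Rad : R) (F : V -> V) (q : 'M[R]_N -> R) : R :=
  inf [set q (jac F z) | z in inD Rad].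

(* P(z) (lifted around the lift z), with R_Lambda/2 = 1/4 *)
Definition Pset (Rad : R) (z : V) : set V :=
  [set w | inD Rad w /\ enorm (lam w - lam z) <= 4^-1].
Definition intmx (Rad : R) (F : V -> V) (z : V) (P Q : pred 'I_N) : set 'M[R]_N :=
  [set A | forall i j, P i -> Q j ->
     inf [set jac F w i j | w in Pset Rad z] <= A i j /\
     A i j <= sup [set jac F w i j | w in Pset Rad z]].
Definition mint (Rad : R) (F : V -> V) (z : V) (P Q : pred 'I_N) : R :=
  inf [set mco A P Q | A in intmx Rad F z P Q].

Definition mu_s1 Rad F K := supD Rad F (fun A => opn A Iy Iy + K^-1 * opn A Iy Ilx).
Definition mu_s2 Rad F K := supD Rad F (fun A => opn A Iy Iy + K * opn A Ilx Iy).
Definition xi_u1 Rad F K := infD Rad F (fun A => mco A Ix Ix - K^-1 * opn A Ix Ily).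
Definition xi_u1P Rad F K :=
  inf [set mint Rad F z Ix Ix | z in inD Rad] - K^-1 * supD Rad F (fun A => opn A Ix Ily).
Definition xi_u2 Rad F K := infD Rad F (fun A => mco A Ix Ix - K * opn A Ily Ix).
Definition mu_cs1 Rad F K := supD Rad F (fun A => opn A Ily Ily + K * opn A Ily Ix).
Definition mu_cs2 Rad F K := supD Rad F (fun A => opn A Ily Ily + K^-1 * opn A Ix Ily).
Definition xi_cu1 Rad F K := infD Rad F (fun A => mco A Ilx Ilx - K * opn A Ilx Iy).
Definition xi_cu1P Rad F K :=
  inf [set mint Rad F z Ilx Ilx | z in inD Rad] - K * supD Rad F (fun A => opn A Ilx Iy).
Definition xi_cu2 Rad F K := infD Rad F (fun A => mco A Ilx Ilx - K^-1 * opn A Iy Ilx).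

Definition rate_conditions (k : nat) Rad F L : Prop :=
  (0 < xi_u1 Rad F L /\ 0 < xi_u1P Rad F L /\ 0 < xi_u2 Rad F L /\
   0 < xi_cu1 Rad F L /\ 0 < xi_cu1P Rad F L /\ 0 < xi_cu2 Rad F L) /\
  (mu_s1 Rad F L < 1 /\ 1 < xi_u1P Rad F L) /\
  mu_cs1 Rad F L < xi_u1P Rad F L /\
  mu_s1 Rad F L < xi_cu1P Rad F L /\
  (forall j : nat, (1 <= j <= k)%N ->
     mu_cs1 Rad F L ^+ j.+1 < xi_u2 Rad F L /\ mu_s2 Rad F L < xi_cu1 Rad F L ^+ j.+1) /\
  mu_cs2 Rad F L < xi_u1 Rad F L /\
  mu_s1 Rad F L < xi_cu2 Rad F L.

(* cones (differences computed in lifts: up to a lattice translation) *)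
Definition inJs (z : V) (K : R) (w : V) : Prop :=
  exists d, latt d /\ enorm (lamx (w + d - z)) <= K * enorm (yc (w - z)).
Definition inJu (z : V) (K : R) (w : V) : Prop :=
  exists d, latt d /\ enorm (lamy (w + d - z)) <= K * enorm (xc (w - z)).

Definition backward_cone Rad (F : V -> V) L : Prop :=
  forall z1 z2, inD Rad z1 -> inD Rad z2 -> inD Rad (F z1) -> inD Rad (F z2) ->
    inJs (F z2) L^-1 (F z1) -> inJs z2 L^-1 z1.

(* covering conditions; U = J_u(z,1/L) /\ D is taken in its lift near the lift z
   (unique, since there ||Delta lambda|| <= 2 Rad / L < 1/2); R_Lambda = 1/2 *)
Definition Dlam Rad (l : 'rV[R]_c) (p : V) : Prop :=
  enorm (lam p - l) <= 2^-1 /\ enorm (xc p) <= Rad /\ enorm (yc p) <= Rad.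
Definition Dplus Rad (l : 'rV[R]_c) (p : V) : Prop :=
  enorm (lam p - l) <= 2^-1 /\ enorm (xc p) <= Rad /\ enorm (yc p) = Rad.
Definition Dminus Rad (l : 'rV[R]_c) (p : V) : Prop :=
  enorm (lam p - l) <= 2^-1 /\ enorm (xc p) = Rad /\ enorm (yc p) < Rad.

Definition covering Rad (F : V -> V) L : Prop :=
  forall z, inD Rad z ->
  let U := [set w | inD Rad w /\ enorm (lamy (w - z)) <= L^-1 * enorm (xc (w - z))] in
  exists (lst : 'rV[R]_c) (h : R -> V -> V) (A : 'M[R]_u),
    [/\ {within [set p : R * V | 0 <= p.1 <= 1 /\ U p.2], continuous (fun p => h p.1 p.2)},
        (forall a w, 0 <= a <= 1 -> U w -> enorm (lam (h a w) - lst) < 2^-1) &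
        (forall w, U w -> latt (h 0 w - F w)) ] /\
    [/\ (forall a w, 0 <= a <= 1 -> U w -> Dminus Rad (lam z) w -> ~ Dlam Rad lst (h a w)),
        (forall a w, 0 <= a <= 1 -> U w -> ~ Dplus Rad lst (h a w)),
        (forall w, U w -> h 1 w = row_mx (row_mx lst (xc w *m A^T)) 0) &
        (forall x : 'rV[R]_u, enorm x = Rad -> Rad < enorm (x *m A^T))].

Definition Wcs Rad (F : V -> V) : set V := [set z | forall n, inD Rad (iter n F z)].

End Defs.

(* Main.v *)
(** Let [z1], [z2] be (lifts of) points of [W^cs], and let [X n], [Y n] be the norms
    of the x- and of the (lambda, y)-component of the difference of their n-th
    iterates.  One step gives [X' >= m X - A Y] and [Y' <= a Y + b X], where
    [a + t b] is at most the [mu] of slope [t].  On the slopes [M <= t <= L] one has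
    [xi > mu]: this holds at [M] by hypothesis, at [L] by the rate conditions, and
    in between by concavity of [xi - mu] in [t].  Hence a slope [X / Y > M] grows
    geometrically until it exceeds [L], after which [X] itself grows like a power of
    [xi_u1P > 1], contradicting [X <= 2 Rad]. *)

Require Import Defs.
From mathcomp Require Import all_boot all_order all_algebra.
From mathcomp Require Import all_classical all_reals all_analysis.
From mathcomp Require Import ring lra.
Import Order.TTheory GRing.Theory Num.Theory.
Import numFieldNormedType.Exports.
Local Open Scope classical_set_scope.
Local Open Scope ring_scope.

Set Implicit Arguments. Unset Strict Implicit. Unset Printing Implicit Defensive.

(** * Euclidean norm: Cauchy-Schwarz and triangle inequality *)

Section Euclid.
Context {R : realType} {n : nat}.
Implicit Types v w : 'rV[R]_n.

Lemma sum_sqr_ge0 v : 0 <= \sum_i v 0 i ^+ 2.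
Proof. by apply: sumr_ge0 => i _; exact: sqr_ge0. Qed.

Lemma enorm_ge0 v : 0 <= enorm v.
Proof. exact: sqrtr_ge0. Qed.

Lemma enorm_sqr v : enorm v ^+ 2 = \sum_i v 0 i ^+ 2.
Proof. by rewrite sqr_sqrtr // sum_sqr_ge0. Qed.

Lemma coord_le_enorm v i : `|v 0 i| <= enorm v.
Proof.
rewrite -(ler_pXn2r (n := 2)) ?nnegrE ?enorm_ge0 // enorm_sqr real_normK ?num_real //.
by rewrite (bigD1 i) //= lerDl; apply: sumr_ge0 => j _; exact: sqr_ge0.
Qed.

Lemma enorm_eq0 v : (enorm v == 0) = (v == 0).
Proof.
apply/eqP/eqP => [v0|->].
  apply/rowP => i; rewrite mxE; apply/eqP; rewrite -normr_le0 -v0.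
  exact: coord_le_enorm.
by rewrite /enorm big1 ?sqrtr0 // => i _; rewrite mxE expr0n.
Qed.

Lemma enorm0 : enorm (0 : 'rV[R]_n) = 0.
Proof. by apply/eqP; rewrite enorm_eq0. Qed.

Lemma enormZ (a : R) v : enorm (a *: v) = `|a| * enorm v.
Proof.
rewrite /enorm -sqrtr_sqr -sqrtrM ?sqr_ge0 //; congr Num.sqrt.
by rewrite mulr_sumr; apply: eq_bigr => i _; rewrite mxE exprMn.
Qed.

Lemma enormN v : enorm (- v) = enorm v.
Proof. by rewrite -scaleN1r enormZ normrN1 mul1r. Qed.

(** Cauchy-Schwarz: with [a] and [b] the norms of [v] and [w], expand the nonnegative sum of the
    squares [(b v_i - a w_i)^2] and divide by [2 a b]. *)
Lemma enorm_dot v w : \sum_i v 0 i * w 0 i <= enorm v * enorm w.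
Proof.
have [->|v0] := eqVneq v 0.
  by rewrite big1 ?mulr_ge0 ?enorm_ge0 // => i _; rewrite mxE mul0r.
have [->|w0] := eqVneq w 0.
  by rewrite big1 ?mulr_ge0 ?enorm_ge0 // => i _; rewrite mxE mulr0.
set a := enorm v; set b := enorm w.
have a0 : 0 < a by rewrite lt_def enorm_eq0 v0 enorm_ge0.
have b0 : 0 < b by rewrite lt_def enorm_eq0 w0 enorm_ge0.
have : 0 <= \sum_i (b * v 0 i - a * w 0 i) ^+ 2.
  by apply: sumr_ge0 => i _; exact: sqr_ge0.
rewrite (eq_bigr (fun i => b ^+ 2 * v 0 i ^+ 2 + a ^+ 2 * w 0 i ^+ 2 -
  (2 * a * b) * (v 0 i * w 0 i))); last by move=> i _; ring.
rewrite sumrB big_split /= -!mulr_sumr -!enorm_sqr -/a -/b.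
set S := \sum_i _ => h.
rewrite -(ler_pM2l (_ : 0 < 2 * a * b)) ?mulr_gt0 //.
by rewrite -subr_ge0; apply: le_trans h _; rewrite le_eqVlt; apply/orP; left; apply/eqP; ring.
Qed.

Lemma enormD v w : enorm (v + w) <= enorm v + enorm w.
Proof.
rewrite -(ler_pXn2r (n := 2)) ?nnegrE ?addr_ge0 ?enorm_ge0 // enorm_sqr.
rewrite (eq_bigr (fun i => v 0 i ^+ 2 + w 0 i ^+ 2 + 2 * (v 0 i * w 0 i))); last first.
  by move=> i _; rewrite mxE; ring.
rewrite !big_split /= -mulr_sumr -!enorm_sqr.
have := enorm_dot v w; nra.
Qed.

Lemma enorm_le_sum v : enorm v <= \sum_i `|v 0 i|.
Proof.
rewrite -(ler_pXn2r (n := 2)) ?nnegrE ?enorm_ge0 ?sumr_ge0 // enorm_sqr.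
rewrite expr2 mulr_suml; apply: ler_sum => i _.
rewrite -real_normK ?num_real // expr2 ler_wpM2l //.
by rewrite (bigD1 i) //= lerDl sumr_ge0.
Qed.

End Euclid.

(** * Operator norms and conorms of matrix blocks *)

Section Blocks.
Context {R : realType} {c u s : nat}.
Local Notation N := (c + u + s)%N.
Local Notation V := 'rV[R]_N.
Local Notation proj := Defs.proj.
Implicit Types (A : 'M[R]_N) (v : V) (P Q : pred 'I_N).

Lemma appE A v i : app A v 0 i = \sum_j A i j * v 0 j.
Proof. by rewrite mxE; apply: eq_bigr => j _; rewrite mxE mulrC. Qed.

Lemma appD A v w : app A (v + w) = app A v + app A w.
Proof. exact: mulmxDl. Qed.

Lemma projE P v i : proj P v 0 i = if P i then v 0 i else 0.
Proof. by rewrite mxE. Qed.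

Lemma projD P v w : proj P (v + w) = proj P v + proj P w.
Proof. by apply/rowP => i; rewrite !mxE; case: ifP; rewrite ?addr0. Qed.

Lemma suppin_proj Q v : suppin Q (proj Q v).
Proof. by move=> i /negbTE Qi; rewrite projE Qi. Qed.

Lemma proj_compl v : proj (@Ily c u s) v + proj (@Ix c u s) v = v.
Proof. by apply/rowP => i; rewrite !mxE /Ily; case: (Ix i); rewrite ?addr0 ?add0r. Qed.

(** Links the component vectors, in which [inD] and the conclusion are phrased, to the masked full
    vectors on which [opn] and [mco] act. The next two lemmas do the same for the other
    components. *)
Lemma enorm_xc v : enorm (xc v) = enorm (proj (@Ix c u s) v).
Proof.
congr Num.sqrt; rewrite [RHS]big_split_ord /= [X in _ = X + _]big_split_ord /=.
rewrite [X in _ = X + _ + _]big1 ?add0r; last first.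
  by move=> i _; rewrite projE /Ix /= leqNgt ltn_ord /= expr0n.
rewrite [X in _ = _ + X]big1 ?addr0; last first.
  by move=> i _; rewrite projE /Ix /= [(_ < c + u)%N]ltnNge leq_addr andbF expr0n.
apply: eq_bigr => i _; rewrite projE /Ix /= leq_addr ltn_add2l ltn_ord /=.
by rewrite !mxE.
Qed.

Lemma enorm_lamy v : enorm (lamy v) = enorm (proj (@Ily c u s) v).
Proof.
congr Num.sqrt; rewrite [RHS]big_split_ord /= [X in _ = X + _]big_split_ord /=.
rewrite [X in _ = _ + X + _]big1 ?addr0; last first.
  by move=> i _; rewrite projE /Ily /Ix /= leq_addr ltn_add2l ltn_ord expr0n.
rewrite [LHS]big_split_ord /=; congr (_ + _); apply: eq_bigr => i _; rewrite projE /Ily /Ix /=.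
  by rewrite leqNgt ltn_ord /= /lamy row_mxEl !mxE.
by rewrite [(_ < c + u)%N]ltnNge leq_addr andbF /= /lamy row_mxEr !mxE.
Qed.

Lemma enorm_yc v : enorm (yc v) = enorm (proj (@Iy c u s) v).
Proof.
congr Num.sqrt; rewrite [RHS]big_split_ord /= [X in _ = X + _]big1 ?add0r; last first.
  by move=> i _; rewrite projE /Iy /= leqNgt ltn_ord expr0n.
by apply: eq_bigr => i _; rewrite projE /Iy /= leq_addr mxE.
Qed.

(** A crude bound through the l1 norm; it only serves to show that the suprema involved are
    finite. *)
Lemma enorm_proj_app_le A P v (B : R) : (forall i j, `|A i j| <= B) ->
  enorm (proj P (app A v)) <= N%:R * (N%:R * B) * enorm v.
Proof.
move=> AB; apply: le_trans (enorm_le_sum _) _.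
have -> : N%:R * (N%:R * B) * enorm v = \sum_(i < N) \sum_(j < N) B * enorm v.
  by rewrite !sumr_const !card_ord !mulr_natl -!mulrnAl.
apply: ler_sum => i _; rewrite projE.
apply: (@le_trans _ _ `|app A v 0 i|); first by case: ifP; rewrite ?normr0.
rewrite appE; apply: le_trans (ler_norm_sum _ _ _) _; apply: ler_sum => j _.
by rewrite normrM ler_pM ?AB ?coord_le_enorm.
Qed.

(** [sup] takes a default value on unbounded or empty sets, so it must be shown to be a genuine
    supremum before it can bound anything. *)
Lemma opn_has_sup A P Q :
  has_sup [set enorm (proj P (app A v)) | v in [set v | suppin Q v /\ enorm v <= 1]].
Proof.
pose B := \sum_i \sum_j `|A i j|.
have AB i j : `|A i j| <= B.
  rewrite /B (bigD1 i) //= (bigD1 j) //= -addrA lerDl addr_ge0 ?sumr_ge0 // => k _.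
  by rewrite sumr_ge0.
split.
  exists (enorm (proj P (app A 0))), 0 => //; split; first by move=> i _; rewrite mxE.
  by rewrite enorm0.
exists (N%:R * (N%:R * B)) => _ [v [_ v1] <-].
apply: le_trans (enorm_proj_app_le P v AB) _.
by rewrite ler_piMr // !mulr_ge0 // sumr_ge0 // => i _; rewrite sumr_ge0.
Qed.

Lemma opn_ge0 A P Q : 0 <= opn A P Q.
Proof.
apply: (@le_trans _ _ (enorm (proj P (app A 0)))); first exact: enorm_ge0.
apply: ub_le_sup; first by case: (opn_has_sup A P Q).
exists 0 => //; split; first by move=> i _; rewrite mxE.
by rewrite enorm0.
Qed.

Lemma opn_le A P Q v : suppin Q v -> enorm (proj P (app A v)) <= opn A P Q * enorm v.
Proof.
move=> Qv; have [->|v0] := eqVneq v 0.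
  suff -> : proj P (app A 0) = 0 by rewrite enorm0 mulr0.
  by apply/rowP => i; rewrite !mxE; case: ifP => // _; rewrite big1 // => j _; rewrite !mxE mul0r.
have a0 : 0 < enorm v by rewrite lt_def enorm_eq0 v0 enorm_ge0.
have projZ a w : proj P (a *: w) = a *: proj P w.
  by apply/rowP => i; rewrite !mxE; case: ifP; rewrite ?mulr0.
rewrite -ler_pdivrMr //.
have -> : enorm (proj P (app A v)) / enorm v = enorm (proj P (app A ((enorm v)^-1 *: v))).
  by rewrite /app -scalemxAl projZ enormZ ger0_norm ?invr_ge0 ?enorm_ge0 // mulrC.
apply: ub_le_sup; first by case: (opn_has_sup A P Q).
exists ((enorm v)^-1 *: v) => //; split; first by move=> i /Qv vi; rewrite mxE vi mulr0.
by rewrite enormZ ger0_norm ?invr_ge0 ?enorm_ge0 // mulVf ?gt_eqF.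
Qed.

Lemma opn_bound A P Q (B : R) : 0 <= B -> (forall i j, `|A i j| <= B) -> opn A P Q <= N%:R * (N%:R * B).
Proof.
move=> B0 AB; apply: ge_sup; first by case: (opn_has_sup A P Q).
move=> _ [v [_ v1] <-]; apply: le_trans (enorm_proj_app_le P v AB) _.
by rewrite ler_piMr // !mulr_ge0.
Qed.

(** For [v] nonzero, the quotient of the two norms is an upper bound of the set that defines [mco],
    which contains 0. *)
Lemma mco_le A P Q v : suppin Q v -> mco A P Q * enorm v <= enorm (proj P (app A v)).
Proof.
move=> Qv; have [->|v0] := eqVneq v 0.
  by rewrite enorm0 mulr0 enorm_ge0.
have a0 : 0 < enorm v by rewrite lt_def enorm_eq0 v0 enorm_ge0.
rewrite -ler_pdivlMr //; apply: ge_sup.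
  by exists 0 => w _; rewrite mul0r enorm_ge0.
by move=> k /(_ v Qv); rewrite ler_pdivlMr.
Qed.

Lemma mco_ge0 A P Q : 0 <= mco A P Q.
Proof.
rewrite /mco; set E := [set _ | _].
have E0 : E 0 by move=> v _; rewrite mul0r enorm_ge0.
(* If the set is unbounded, [sup] has the default value 0 and the bound still holds. *)
case: (pselect (has_sup E)) => [[_ ubE]|/sup_out -> //].
exact: ub_le_sup.
Qed.

End Blocks.

(** * Directional derivatives and mean value theorems *)

Section MeanValue.
Context {R : realType} {c u s : nat}.
Local Notation N := (c + u + s)%N.
Local Notation V := 'rV[R]_N.

Lemma is_derive_line (g : V -> R) (z v : V) (t d : R) :
  is_derive (z + t *: v) v g d -> is_derive t 1 (fun r : R => g (z + r *: v)) d.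
Proof.
have E : (fun h : R => h^-1 *: (g (h *: v + (z + t *: v)) - g (z + t *: v))) =
         (fun h : R => h^-1 *: (g (z + (h *: 1 + t) *: v) - g (z + t *: v))).
  by apply/funext => h; rewrite scalerDl addrCA [h *: 1]mulr1.
case=> dg <-; apply: DeriveDef.
- by move: dg; rewrite /derivable /= E.
- by rewrite /derive /= E.
Qed.

Lemma MVT_line (g : V -> R) (dg : V -> R) (z v : V) (a b : R) : a <= b ->
  (forall t, t \in `[a, b] -> is_derive (z + t *: v) v g (dg (z + t *: v))) ->
  exists2 t, t \in `[a, b] &
    g (z + b *: v) - g (z + a *: v) = dg (z + t *: v) * (b - a).
Proof.
move=> ab gd.
have gd' t : t \in `[a, b] ->
    is_derive t 1 (fun r : R => g (z + r *: v)) (dg (z + t *: v)).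
  by move=> /gd; exact: is_derive_line.
have gc : {within `[a, b], continuous (fun r : R => g (z + r *: v))}.
  apply: derivable_within_continuous => t /gd' td.
  exact: (@ex_derive _ _ _ _ _ _ _ td).
have gd'' t : t \in `]a, b[ ->
    is_derive t 1 (fun r : R => g (z + r *: v)) (dg (z + t *: v)).
  by move=> tab; apply: gd'; apply: subset_itv_oo_cc tab.
by have [t tab E] := MVT_segment ab gd'' gc; exists t.
Qed.

Lemma MVT_coord (g : V -> R) (z : V) (j : 'I_N) (t : R) :
  (forall r, `|r| <= `|t| -> derivable g (z + r *: delta_mx 0 j) (delta_mx 0 j)) ->
  exists2 r, `|r| <= `|t| &
    g (z + t *: delta_mx 0 j) - g z = t * pd g j (z + r *: delta_mx 0 j).
Proof.
set e := delta_mx 0 j => gd.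
have gd' r : `|r| <= `|t| -> is_derive (z + r *: e) e g (pd g j (z + r *: e)).
  by move=> /gd rd; apply: DeriveDef.
have [t0|t0] := leP 0 t.
  have tin r : r \in `[0, t] -> `|r| <= `|t|.
    by rewrite in_itv /= => /andP[r0 rt]; rewrite !ger0_norm.
  have [r /tin rt] := MVT_line t0 (fun r rt => gd' r (tin r rt)).
  by rewrite scale0r addr0 subr0 mulrC => ->; exists r.
have tin r : r \in `[t, 0] -> `|r| <= `|t|.
  by rewrite in_itv /= => /andP[r0 rt]; rewrite !ler0_norm ?lerN2 // ltW.
have [r /tin rt] := MVT_line (ltW t0) (fun r rt => gd' r (tin r rt)).
rewrite scale0r addr0 => h; exists r => //.
by rewrite -[LHS]opprB h sub0r mulrN opprK mulrC.
Qed.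

(** Moves from [z] to [z + v] along one coordinate axis at a time: [tr k] keeps the first [k]
    coordinates of [v]. Each leg stays in the box, and the one-variable mean value theorem gives its
    increment. *)
Lemma increment_box (g : V -> R) (z v : V) (e : R) :
  (forall p : V, (forall i, `|p 0 i - z 0 i| <= `|v 0 i|) -> forall j,
     derivable g p (delta_mx 0 j) /\ `|pd g j p - pd g j z| <= e) ->
  `|g (z + v) - g z - \sum_j v 0 j * pd g j z| <= e * \sum_j `|v 0 j|.
Proof.
move=> box; pose tr (k : nat) : V := \row_j (if (j < k)%N then v 0 j else 0).
have tr0 : tr 0%N = 0 by apply/rowP => j; rewrite !mxE.
have trN : tr N = v by apply/rowP => j; rewrite !mxE ltn_ord.
have trS (k : 'I_N) : tr k.+1 = tr k + v 0 k *: delta_mx 0 k.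
  apply/rowP => j; rewrite !mxE eqxx /= ltnS leq_eqVlt.
  have [->|jk] := eqVneq j k; first by rewrite ltnn eqxx /= add0r mulr1.
  by rewrite (negbTE (_ : (j : nat) != k)) //= mulr0 addr0.
have -> : g (z + v) - g z = \sum_(k < N) (g (z + tr k.+1) - g (z + tr k)).
  rewrite -(big_mkord xpredT (fun k => g (z + tr k.+1) - g (z + tr k))).
  by rewrite telescope_sumr // trN tr0 addr0.
rewrite -sumrB mulr_sumr; apply: le_trans (ler_norm_sum _ _ _) _.
apply: ler_sum => k _.
have inbox r : `|r| <= `|v 0 k| ->
    forall i, `|(z + tr k + r *: delta_mx 0 k) 0 i - z 0 i| <= `|v 0 i|.
  have E (a b d : R) : a + b + d - a = b + d by ring.
  move=> rv i; rewrite !mxE E eqxx /=.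
  have [->|ik] := eqVneq i k; first by rewrite ltnn add0r mulr1.
  by rewrite mulr0 addr0; case: ifP; rewrite ?normr0.
have [r rv] := MVT_coord (z := z + tr k) (fun r rv => (box _ (inbox r rv) k).1).
rewrite trS addrA => ->; rewrite -mulrBr normrM mulrC ler_wpM2r //.
exact: (box _ (inbox r rv) k).2.
Qed.

(** [Cm] speaks only of derivatives along coordinate axes; their continuity yields the derivative in
    every direction, by [increment_box] on boxes shrinking with [h]. *)
Lemma C1_is_derive (U : set V) (g : V -> R) (z v : V) : open U -> U z ->
  (forall j p, U p -> derivable g p (delta_mx 0 j)) ->
  (forall j, {for z, continuous (pd g j)}) ->
  is_derive z v g (\sum_j v 0 j * pd g j z).
Proof.
move=> oU Uz gd gc.
suff cv : (fun h : R => h^-1 *: (g (h *: v + z) - g z)) @ 0^' -->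
    (\sum_j v 0 j * pd g j z : R^o).
  by apply: DeriveDef; [apply/cvg_ex; eexists; exact: cv|exact: cvg_lim cv].
apply/cvgrPdist_le => e e0.
pose S := \sum_j `|v 0 j|.
have S0 : 0 <= S by apply: sumr_ge0.
have vS j : `|v 0 j| <= S by rewrite /S (bigD1 j) //= lerDl sumr_ge0.
(* [S + 1] instead of [S] keeps the denominator positive when [v] is zero. *)
pose e' := e / (S + 1).
have e'0 : 0 < e' by rewrite divr_gt0 // ltr_wpDl.
have : \forall p \near z, U p /\ forall j, `|pd g j p - pd g j z| <= e'.
  have [] : (\forall p \near z, U p) /\
     (\forall p \near z, forall j, `|pd g j p - pd g j z| <= e').
    split; first exact: open_nbhs_nbhs.
    apply: (@filter_forall V _ (fun j p => `|pd g j p - pd g j z| <= e')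
      (nbhs z) (nbhs_filter z)) => j.
    have /cvgrPdist_le/(_ e' e'0) := gc j.
    by apply: filterS => p; rewrite distrC.
  by move=> h1 h2; near=> p; split; [near: p|near: p].
move=> /nbhs_ballP[d /= d0 dball].
near=> h.
have h0 : h != 0 by near: h; exact: nbhs_dnbhs_neq.
have hd : `|h| * (S + 1) < d.
  rewrite -ltr_pdivlMr ?ltr_wpDl //; near: h; apply: dnbhs0_lt.
  by rewrite divr_gt0 // ltr_wpDl.
rewrite distrC addrC [h *: v + z]addrC.
have -> : - (\sum_j v 0 j * pd g j z) + h^-1 *: (g (z + h *: v) - g z) =
  h^-1 * (g (z + h *: v) - g z - \sum_j (h *: v) 0 j * pd g j z).
  rewrite mulrBr addrC; congr (_ - _).
  by rewrite mulr_sumr; apply: eq_bigr => j _; rewrite mxE -mulrA mulKf.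
have box (p : V) : (forall i, `|p 0 i - z 0 i| <= `|(h *: v) 0 i|) -> forall j,
     derivable g p (delta_mx 0 j) /\ `|pd g j p - pd g j z| <= e'.
  move=> pz j; suff /dball[/gd gp]: ball z d p by [].
  split=> // i k; rewrite ord1 /ball /= distrC; apply: le_lt_trans (pz k) _.
  rewrite mxE normrM; apply: le_lt_trans hd; rewrite ler_wpM2l //.
  by apply: le_trans (vS k) _; rewrite lerDl.
rewrite normrM normfV ler_pdivrMl ?normr_gt0 //.
apply: le_trans (increment_box box) _.
under eq_bigr do rewrite mxE normrM.
rewrite -mulr_sumr -/S mulrCA ler_wpM2l // /e' -mulrA ger_pMr // ler_pdivrMl ?ltr_wpDl //.
by rewrite mulr1 lerDl.
Unshelve. all: by end_near. Qed.

(** The part of [Cm] that is used. Continuity of [F] itself serves the periodicity of the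
    Jacobian. *)
Definition C1 (U : set V) (F : V -> V) : Prop :=
  [/\ open U, forall i j p, U p -> derivable (fun q => F q 0 i) p (delta_mx 0 j),
      forall i j p, U p -> {for p, continuous (fun q => jac F q i j)} &
      forall i p, U p -> {for p, continuous (fun q => F q 0 i)}].

Lemma Cm_C1 (U : set V) (F : V -> V) (k : nat) : open U ->
  (forall i, Cm k.+1 U (fun q => F q 0 i)) -> C1 U F.
Proof.
move=> oU FC; split=> // [i j p Up|i j p Up|i p Up].
- by case: (FC i [::]) => // _ /(_ isT) /(_ j p Up).
- case: (FC i [:: j]) => // /(_ p Up) h _; move: h.
  by rewrite (_ : (fun q => jac F q i j) = iterpd [:: j] (fun q => F q 0 i)) //; apply/funext => q; rewrite mxE.
- by case: (FC i [::]) => // /(_ p Up).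
Qed.

(** A vector-valued map has no common intermediate point for all coordinates, but the scalar product
    with a fixed [q] is a real function on the segment. Later [q] is the projected increment itself
    or a coordinate vector. *)
Lemma MVT_weighted (U : set V) (F : V -> V) (z v q : V) : C1 U F ->
  (forall t, t \in `[0, 1] -> U (z + t *: v)) ->
  exists2 t : R, t \in `[0, 1] &
    \sum_i q 0 i * (F (z + v) - F z) 0 i =
    \sum_i q 0 i * app (jac F (z + t *: v)) v 0 i.
Proof.
case=> oU Fd Fc _ seg.
pose g p := \sum_i q 0 i *: (F p 0 i : R^o).
pose dg p := \sum_i q 0 i * app (jac F p) v 0 i.
have gd t : t \in `[0, 1] -> is_derive (z + t *: v) v g (dg (z + t *: v)).
  move=> /seg Up; rewrite /g /dg.
  have -> : (fun p => \sum_i q 0 i *: (F p 0 i : R^o)) =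
            \sum_i (q 0 i \*: (fun p => F p 0 i : R^o)).
    by apply/funext => p; rewrite fct_sumE.
  apply: is_derive_sum => i.
  apply: is_deriveZ.
  rewrite appE.
  have -> : \sum_j jac F (z + t *: v) i j * v 0 j =
      \sum_j v 0 j * pd (fun w => F w 0 i) j (z + t *: v).
    by apply: eq_bigr => j _; rewrite mxE mulrC.
  apply: (C1_is_derive (U := U)) => //; first by move=> j p; exact: Fd.
  move=> j; have := Fc i j _ Up; rewrite (_ : (fun q0 : V => jac F q0 i j) = pd (fun w => F w 0 i) j) //.
  by apply/funext => p; rewrite mxE.
have [t t01 E] := MVT_line ler01 gd.
exists t => //; move: E; rewrite scale1r scale0r addr0 subr0 mulr1 /dg => {}E.
rewrite -E.
by rewrite /g -sumrB; apply: eq_bigr => i _; rewrite !mxE mulrBr.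
Qed.

End MeanValue.

(** * Lattice periodicity and boundedness of the Jacobian on the lifted domain *)

Section Bounds.
Context {R : realType} {c u s : nat}.
Local Notation N := (c + u + s)%N.
Local Notation V := 'rV[R]_N.
Local Notation proj := Defs.proj.
Context (Rad : R) (F : V -> V) (U : set V).
Hypotheses (FC1 : C1 U F) (DU : inD Rad `<=` U).

Lemma xcD (z w : V) : xc (z + w) = xc z + xc w.
Proof. by apply/rowP => i; rewrite !mxE. Qed.

Lemma ycD (z w : V) : yc (z + w) = yc z + yc w.
Proof. by apply/rowP => i; rewrite !mxE. Qed.

Lemma xcZ a (z : V) : xc (a *: z) = a *: xc z.
Proof. by apply/rowP => i; rewrite !mxE. Qed.

Lemma ycZ a (z : V) : yc (a *: z) = a *: yc z.
Proof. by apply/rowP => i; rewrite !mxE. Qed.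

Lemma inD_convex (z v : V) (t : R) : t \in `[0, 1] -> inD Rad z -> inD Rad (z + v) ->
  inD Rad (z + t *: v).
Proof.
rewrite in_itv /= => /andP[t0 t1] [zx zy] [vx vy].
have -> : z + t *: v = (1 - t) *: z + t *: (z + v).
  by rewrite scalerDr addrA -scalerDl subrK scale1r.
move: vx vy; move: (z + v) => w wx wy.
have t1' : 0 <= 1 - t by rewrite subr_ge0.
have conv n (a b : 'rV[R]_n) : enorm a <= Rad -> enorm b <= Rad ->
    enorm ((1 - t) *: a + t *: b) <= Rad.
  move=> ha hb; apply: le_trans (enormD _ _) _.
  by rewrite !enormZ !ger0_norm //; nra.
by split; rewrite ?xcD ?ycD ?xcZ ?ycZ; exact: conv.
Qed.

Lemma latt_inD (z d : V) : latt d -> inD Rad z -> inD Rad (z + d).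
Proof.
move=> dl [zx zy].
have xd : xc d = 0.
  apply/rowP => i; have := dl (lshift s (rshift c i)).
  by rewrite !mxE /= ltnNge leq_addr /= => /eqP.
have yd : yc d = 0.
  apply/rowP => i; have := dl (rshift (c + u) i).
  by rewrite !mxE /= ltnNge -addnA leq_addr /= => /eqP.
by split; rewrite ?xcD ?ycD ?xd ?yd addr0.
Qed.

Lemma latt_coord_eq (d e : V) i : latt d -> latt e -> `|d 0 i - e 0 i| < 1 -> d 0 i = e 0 i.
Proof.
move=> /(_ i) + /(_ i); case: ifP => _; last by move=> /eqP-> /eqP->.
move=> di ei de; apply/eqP; rewrite -subr_eq0; apply: contraTT de => ne.
by rewrite -leNgt norm_intr_ge1 // rpredB.
Qed.

(** The coordinates of [F (q + d) - F q] are continuous in [q] near [z] and either integers or 0,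
    hence locally constant; so the translate of [F] by [d] differs from [F] by a constant near
    [z]. *)
Lemma jac_periodic (z d : V) : (forall z d : V, latt d -> latt (F (z + d) - F z)) ->
  latt d -> inD Rad z -> jac F (z + d) = jac F z.
Proof.
move=> Flatt dl zD; have [oU _ _ Fcont] := FC1.
apply/matrixP => i j; rewrite !mxE /pd.
set e := delta_mx 0 j; set g : V -> R := fun q => F q 0 i.
have -> : 'D_e g (z + d) = 'D_e (fun q => g (q + d)) z.
  have E : (fun h : R => h^-1 *: (g (h *: e + (z + d)) - g (z + d))) =
           (fun h : R => h^-1 *: (g (h *: e + z + d) - g (z + d))).
    by apply/funext => h; rewrite addrA.
  by rewrite /derive /= E.
pose C := g (z + d) - g z.
have -> : 'D_e g z = 'D_e (g + cst C) z.
  by rewrite deriveD ?derive_cst ?addr0 //; have [_ Fd _ _] := FC1; apply: Fd; exact: DU.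
apply: near_eq_derive.
have nz := nbhs_filter z.
have sc : {for z, continuous (fun q : V => q + d)}.
  exact: (cvgD (f := id) (g := cst d) cvg_id (cvg_cst d)).
have gdc : {for z, continuous (g \o (fun q : V => q + d))}.
  by apply: continuous_comp sc _; exact: Fcont (DU (latt_inD dl zD)).
have gc : {for z, continuous (fun q : V => g (q + d) - g q)}.
  exact: (cvgB gdc (Fcont i _ (DU zD))).
have /cvgr_dist_lt/(_ 1 ltr01) := gc; apply: filterS => q.
rewrite distrC => zq; suff : g (q + d) - g q = C.
  by move=> <-; rewrite !fctE /=; ring.
have := @latt_coord_eq (F (q + d) - F q) (F (z + d) - F z) i (Flatt _ _ dl) (Flatt _ _ dl).
by rewrite !mxE; apply.
Qed.

Lemma continuous_enorm_proj P : continuous (fun z : V => enorm (proj P z)).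
Proof.
move=> z; apply: (@continuous_comp _ _ _ (fun z : V => \sum_i (proj P z) 0 i ^+ 2) Num.sqrt);
  last exact: sqrt_continuous.
move: z; apply: continuous_big; first exact: add_continuous.
move=> i _ z; apply: (@continuous_comp _ _ _ (fun z : V => (proj P z) 0 i) (fun x => x ^+ 2));
  last exact: exprn_continuous.
have -> : (fun z0 : V => (proj P z0) 0 i : R) =
    (if P i then (fun z0 : V => z0 0 i : R) else cst 0).
  by apply: (@funext V R) => p; rewrite projE; case: (P i).
by case: (P i); [exact: coord_continuous|exact: cst_continuous].
Qed.

Lemma closed_inD : closed (inD Rad : set V).
Proof.
have -> : inD Rad = (fun z : V => enorm (proj (@Ix c u s) z)) @^-1` [set x | x <= Rad] `&`
                    (fun z : V => enorm (proj (@Iy c u s) z)) @^-1` [set x | x <= Rad].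
  by apply/seteqP; split=> z; rewrite /inD /= enorm_xc enorm_yc.
by apply: closedI; apply: preimage_closed; try exact: closed_le;
  move=> z _; exact: continuous_enorm_proj.
Qed.

(** Subtracting integer parts puts the lambda-coordinates into [0, 1); the other coordinates are
    already bounded by [Rad]. *)
Lemma latt_reduce (z : V) : 0 <= Rad -> inD Rad z ->
  exists2 d, latt d & inD Rad (z + d) /\ forall i, `[- (Rad + 1), Rad + 1]%classic ((z + d) 0 i).
Proof.
move=> Rad0 zD.
pose d : V := \row_i (if (i < c)%N then - (Num.floor (z 0 i))%:~R else 0).
have dl : latt d.
  by move=> i; rewrite mxE; case: (i < c)%N; rewrite ?rpredN ?intr_int.
exists d => //; split; first exact: latt_inD.
have [zx zy] := zD => i; rewrite !mxE /= in_itv /=.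
case: ifPn => [_|ic].
  by have := floor_itv (z 0 i); rewrite intrD /=; lra.
suff : `|z 0 i| <= Rad by rewrite addr0 ler_norml; lra.
rewrite -leqNgt in ic.
have [iu|iu] := ltnP i (c + u).
  apply: le_trans zx; rewrite enorm_xc.
  by apply: le_trans (coord_le_enorm _ i); rewrite projE /Ix ic iu.
apply: le_trans zy; rewrite enorm_yc.
by apply: le_trans (coord_le_enorm _ i); rewrite projE /Iy iu.
Qed.

(** The lifted domain is not compact, but by periodicity it suffices to bound the entries on the
    compact set [K], which meets every lattice orbit in the domain. *)
Lemma jac_bounded : 0 <= Rad -> (forall z d : V, latt d -> latt (F (z + d) - F z)) ->
  exists2 B : R, 0 <= B & forall z, inD Rad z -> forall i j, `|jac F z i j| <= B.
Proof.
move=> Rad0 Flatt; have [oU _ Fc _] := FC1.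
pose K : set V := [set v : V | forall i, `[- (Rad + 1), Rad + 1]%classic (v ord0 i)] `&` (inD Rad : set V).
have cK : compact K.
  apply: compact_closedI; last exact: closed_inD.
  by apply: (@rV_compact R N (fun=> `[- (Rad + 1), Rad + 1]%classic)) => i; exact: segment_compact.
have K0 : K 0.
  split; first by move=> i; rewrite /= mxE in_itv /=; lra.
  by split; rewrite (_ : _ 0 = 0) ?enorm0 //; apply/rowP => i; rewrite !mxE.
have bd (ij : 'I_N * 'I_N) : exists B, forall z, K z -> `|jac F z ij.1 ij.2| <= B.
  have jc : {within K, continuous (fun z : V => `|jac F z ij.1 ij.2|)}.
    apply: continuous_in_subspaceT => z; rewrite inE => -[_ /DU zU].
    apply: (@continuous_comp _ _ _ (fun z : V => jac F z ij.1 ij.2) Num.norm).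
      exact: Fc.
    exact: norm_continuous.
  have [p _ pmax] := compact_EVT_max (ex_intro _ 0 K0) cK jc.
  by exists (`|jac F p ij.1 ij.2|) => z Kz; apply: pmax; rewrite inE.
have [b bP] := choice bd.
exists (\sum_ij `|b ij|); first by rewrite sumr_ge0.
move=> z zD i j; have [d dl [dD dI]] := latt_reduce Rad0 zD.
rewrite -(jac_periodic Flatt dl zD).
apply: le_trans (bP (i, j) (z + d) _) _; first by split.
rewrite (bigD1 (i, j)) //=; apply: le_trans (ler_norm _) _.
by rewrite lerDl sumr_ge0.
Qed.

End Bounds.

(** * One-step estimates for differences of two points *)

Section Estimates.
Context {R : realType} {c u s : nat}.
Local Notation N := (c + u + s)%N.
Local Notation V := 'rV[R]_N.
Local Notation proj := Defs.proj.
Local Notation Ix := (@Ix c u s).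
Local Notation Ily := (@Ily c u s).
Context (Rad B : R) (F : V -> V) (U : set V).
Hypotheses (FC1 : C1 U F) (DU : inD Rad `<=` U) (B0 : 0 <= B).
Hypothesis FB : forall z, inD Rad z -> forall i j, `|jac F z i j| <= B.

(** The weighted mean value theorem with the projected increment [q] as weight gives the square of
    its norm; Cauchy-Schwarz then allows one factor to be cancelled. *)
Lemma MVT_norm P (z v : V) : inD Rad z -> inD Rad (z + v) ->
  exists2 p, inD Rad p &
    enorm (proj P (F (z + v) - F z)) <= enorm (proj P (app (jac F p) v)).
Proof.
move=> zD vD; set q := proj P (F (z + v) - F z).
have seg (t : R) : t \in `[0, 1] -> U (z + t *: v).
  by move=> t01; apply: DU; exact: inD_convex.
have [t t01 E] := MVT_weighted q FC1 seg.
exists (z + t *: v); first exact: inD_convex.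
set w := app _ v in E *.
have qq : enorm q ^+ 2 = \sum_i q 0 i * (F (z + v) - F z) 0 i.
  rewrite enorm_sqr; apply: eq_bigr => i _; rewrite expr2 /q !projE.
  by case: ifP => // _; rewrite !mul0r.
have qw : \sum_i q 0 i * w 0 i = \sum_i q 0 i * proj P w 0 i.
  by apply: eq_bigr => i _; rewrite /q !projE; case: ifP => // _; rewrite !mul0r.
have := enorm_dot q (proj P w); rewrite -qw -E -qq expr2.
have [->|q0] := eqVneq (enorm q) 0; first by rewrite enorm_ge0.
by rewrite ler_pM2l // lt_def q0 enorm_ge0.
Qed.

Lemma supD_ub (q : 'M[R]_N -> R) (C : R) (z : V) :
  (forall p, inD Rad p -> q (jac F p) <= C) -> inD Rad z -> q (jac F z) <= supD Rad F q.
Proof.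
by move=> qC zD; apply: ub_le_sup; [exists C => _ [p pD <-]; exact: qC|exists z].
Qed.

Lemma opn_le_supD P Q (z : V) : inD Rad z ->
  opn (jac F z) P Q <= supD Rad F (fun A => opn A P Q).
Proof.
by apply: (supD_ub (C := N%:R * (N%:R * B))) => p /FB pB; exact: opn_bound.
Qed.

Lemma opnD_le_supD P Q P' Q' (K : R) (z : V) : 0 <= K -> inD Rad z ->
  opn (jac F z) P Q + K * opn (jac F z) P' Q' <=
  supD Rad F (fun A => opn A P Q + K * opn A P' Q').
Proof.
move=> K0; apply: (@supD_ub (fun A => opn A P Q + K * opn A P' Q')
  (N%:R * (N%:R * B) + K * (N%:R * (N%:R * B)))) => p /FB pB.
by rewrite lerD ?ler_wpM2l ?opn_bound.
Qed.

Lemma mint_ge0 (z : V) P Q : 0 <= mint Rad F z P Q.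
Proof.
rewrite /mint; set E := [set _ | _ in _].
have lbE : lbound E 0 by move=> _ [A _ <-]; exact: mco_ge0.
case: (pselect (E !=set0)) => [E0|]; first exact: lb_le_inf.
by move=> /set0P/negP/negPn/eqP ->; rewrite inf0.
Qed.

Lemma inf_mint_le (z : V) P Q A : inD Rad z -> intmx Rad F z P Q A ->
  inf [set mint Rad F p P Q | p in inD Rad] <= mco A P Q.
Proof.
move=> zD zA; apply: (@le_trans _ _ (mint Rad F z P Q)).
  by apply: ge_inf; [exists 0 => _ [p _ <-]; exact: mint_ge0|exists z].
by apply: ge_inf; [exists 0 => _ [C _ <-]; exact: mco_ge0|exists A].
Qed.

(** The enclosure constrains each entry separately, so the rows may be taken at different points of
    P(z). The bound [B] makes the infima and suprema genuine. *)
Lemma intmx_rows (z : V) P Q (A : 'M[R]_N) (p : 'I_N -> V) : (forall i, Pset Rad z (p i)) ->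
  (forall i j, A i j = jac F (p i) i j) -> intmx Rad F z P Q A.
Proof.
move=> pP Ap i j _ _; rewrite Ap.
have bd q : Pset Rad z q -> - B <= jac F q i j <= B.
  by move=> [/FB/(_ i j)]; rewrite ler_norml.
split.
- by apply: ge_inf; [exists (- B) => _ [q /bd/andP[? _] <-]|exists (p i)].
- by apply: ub_le_sup; [exists B => _ [q /bd/andP[_ ?] <-]|exists (p i)].
Qed.

(* The increment is split at z2 + proj Ily (z1 - z2): along the first leg only x
   moves, so it stays in a single P(z) whatever the distance between the
   lambda-components, and a row-by-row mean value theorem gives a matrix in the
   interval enclosure. *)
Lemma expansion_x (z1 z2 : V) : inD Rad z1 -> inD Rad z2 ->
  inf [set mint Rad F p Ix Ix | p in inD Rad] * enorm (proj Ix (z1 - z2))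
    - supD Rad F (fun A => opn A Ix Ily) * enorm (proj Ily (z1 - z2))
  <= enorm (proj Ix (F z1 - F z2)).
Proof.
move=> z1D z2D.
set vx := proj Ix (z1 - z2); set vy := proj Ily (z1 - z2).
set z := z2 + vy.
have zvx : z + vx = z1 by rewrite /z -addrA proj_compl addrC subrK.
have xy : xc vy = 0.
  by apply/eqP; rewrite -enorm_eq0 enorm_xc; apply/eqP; rewrite -[RHS](@enorm0 R N);
    congr enorm; apply/rowP => i; rewrite !mxE /Defs.Ily; case: (Defs.Ix i).
have yx : yc vx = 0.
  apply/rowP => i; rewrite !mxE /Defs.Ix /=.
  by rewrite [(_ < c + u)%N]ltnNge leq_addr andbF.
have lx : lam vx = 0.
  by apply/rowP => i; rewrite !mxE /Defs.Ix /= leqNgt ltn_ord.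
have zD : inD Rad z.
  split; first by rewrite /z xcD xy addr0; case: z2D.
  suff -> : yc z = yc z1 by case: z1D.
  by rewrite -zvx ycD yx addr0.
have v1D : inD Rad (z + vx) by rewrite zvx.
have seg (t : R) : t \in `[0, 1] -> inD Rad (z + t *: vx).
  by move=> t01; exact: inD_convex.
(* The weight is the i-th coordinate vector, so the intermediate point depends on the row. *)
have row i : exists t : R, t \in `[0, 1] /\
    (F z1 - F z) 0 i = app (jac F (z + t *: vx)) vx 0 i.
  have [t t01] := MVT_weighted (delta_mx 0 i) FC1 (fun t t01 => DU (seg t t01)).
  have dE (q : V) : \sum_k (delta_mx 0 i : V) 0 k * q 0 k = q 0 i.
    rewrite (bigD1 i) //= !mxE !eqxx mul1r big1 ?addr0 // => k /negbTE ki.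
    by rewrite mxE eqxx /= ki mul0r.
  by rewrite !dE zvx => E; exists t.
have [t tP] := choice row.
pose A : 'M[R]_N := \matrix_(i, j) jac F (z + t i *: vx) i j.
have zA : intmx Rad F z Ix Ix A.
  apply: (@intmx_rows _ _ _ _ (fun i => z + t i *: vx)) => [i|i j]; last by rewrite mxE.
  split; first by apply: seg; case: (tP i).
  rewrite (_ : lam _ - lam z = t i *: lam vx); last first.
    by apply/rowP => j; rewrite !mxE addrC addKr.
  by rewrite lx scaler0 enorm0.
have FA : F z1 - F z = app A vx.
  apply/rowP => i; have [_ ->] := tP i; rewrite !appE.
  by apply: eq_bigr => j _; rewrite [A _ _]mxE.
have h1 : inf [set mint Rad F p Ix Ix | p in inD Rad] * enorm vx <=
    enorm (proj Ix (F z1 - F z)).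
  rewrite FA; apply: le_trans (mco_le A Ix (@suppin_proj _ _ _ _ Ix (z1 - z2))).
  by rewrite ler_wpM2r ?enorm_ge0 // (inf_mint_le zD).
(* The second leg may be long in lambda; this is harmless, since its bound is a supremum over all of
   D. *)
have [p pD h2] := MVT_norm Ix z2D zD.
have h3 : enorm (proj Ix (F z - F z2)) <=
    supD Rad F (fun A => opn A Ix Ily) * enorm vy.
  apply: le_trans h2 _; apply: le_trans (opn_le _ Ix (@suppin_proj _ _ _ _ Ily (z1 - z2))) _.
  by rewrite ler_wpM2r ?enorm_ge0 ?opn_le_supD.
have -> : F z1 - F z2 = (F z1 - F z) + (F z - F z2) by rewrite addrA subrK.
(* Reverse triangle inequality for the two legs. *)
have := enormD (proj Ix (F z1 - F z) + proj Ix (F z - F z2)) (- proj Ix (F z - F z2)).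
by rewrite addrK enormN -projD; lra.
Qed.

(** [a] and [b] are block norms of one Jacobian at one point, chosen before [K]: the same pair then
    obeys the bounds for slope [M] and for slope [L]. *)
Lemma contraction_ly (z1 z2 : V) : inD Rad z1 -> inD Rad z2 ->
  exists a b : R, [/\ 0 <= a, 0 <= b,
    forall K, 0 <= K -> a + K * b <= supD Rad F (fun A => opn A Ily Ily + K * opn A Ily Ix) &
    enorm (proj Ily (F z1 - F z2)) <=
      a * enorm (proj Ily (z1 - z2)) + b * enorm (proj Ix (z1 - z2))].
Proof.
move=> z1D z2D.
have zE : z2 + (z1 - z2) = z1 by rewrite addrC subrK.
have [|p pD] := @MVT_norm Ily z2 (z1 - z2) z2D; first by rewrite zE.
rewrite zE => h.
exists (opn (jac F p) Ily Ily), (opn (jac F p) Ily Ix); split; try exact: opn_ge0.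
  by move=> K K0; exact: opnD_le_supD.
apply: le_trans h _; rewrite -[X in app _ X](proj_compl (z1 - z2)) appD projD.
by apply: le_trans (enormD _ _) _; rewrite lerD // opn_le //; exact: suppin_proj.
Qed.

End Estimates.

(** * Growth of slopes for two real sequences *)

Section Growth.
Context {R : realType}.

(** Bernoulli's inequality and the Archimedean property. *)
Lemma exp_unbounded (q C : R) : 1 < q -> exists n, C < q ^+ n.
Proof.
move=> q1; have q10 : 0 < q - 1 by rewrite subr_gt0.
have bern n : 1 + n%:R * (q - 1) <= q ^+ n.
  elim: n => [|n IHn]; first by rewrite mul0r addr0 expr0.
  rewrite exprS -natr1; apply: (@le_trans _ _ (q * (1 + n%:R * (q - 1)))).
    have : 0 <= n%:R * (q - 1) * (q - 1) by rewrite !mulr_ge0 // ltW.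
    by move: (n%:R) => x; lra.
  by rewrite ler_pM2l //; exact: lt_trans q1.
exists (Num.bound (`|C| / (q - 1))); apply: lt_le_trans (bern _).
apply: le_lt_trans (ler_norm C) _.
have : `|C| / (q - 1) < (Num.bound (`|C| / (q - 1)))%:R.
  by apply: archi_boundP; rewrite divr_ge0 // ltW.
by rewrite ltr_pdivrMr // => h; apply: lt_trans h _; rewrite ltrDr.
Qed.

(** The dynamical core, by contradiction from an initial slope above [M]. A slope at least [t] is
    written [t * Y n <= X n], which allows [Y n = 0]. *)
Lemma slope_bound (X Y : nat -> R) (m A muM muL M L C : R) :
  0 < M -> M < L -> 0 <= A ->
  (forall n, 0 <= X n <= C) -> (forall n, 0 <= Y n) ->
  muM < m - M^-1 * A -> muL < m - L^-1 * A -> 1 < m - L^-1 * A ->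
  (forall n, m * X n - A * Y n <= X n.+1) ->
  (forall n, exists a b : R, [/\ 0 <= a, 0 <= b, a + M * b <= muM, a + L * b <= muL &
     Y n.+1 <= a * Y n + b * X n]) ->
  X 0%N <= M * Y 0%N.
Proof.
move=> M0 ML A0 XC Y0 hM hL hL1 stepX stepY.
set xM := m - M^-1 * A in hM *; set xL := m - L^-1 * A in hL hL1 *.
have L0 : 0 < L by exact: lt_trans ML.
rewrite leNgt; apply/negP => X0.
have [muM0 muL0] : 0 <= muM /\ 0 <= muL.
  by have [a [b [a0 b0 aM aL _]]] := stepY 0%N; split; nra.
(* One growth factor [q = 1 + d] for both ends: [d] is the smaller gap divided by a positive number
   exceeding [muM] and [muL]. *)
have [q q1 [qM qL]] : exists2 q, 1 < q & q * muM <= xM /\ q * muL <= xL.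
  pose d := Num.min (xM - muM) (xL - muL) / (muM + muL + 1).
  have S0 : 0 < muM + muL + 1 by lra.
  have n0 : 0 < Num.min (xM - muM) (xL - muL) by rewrite lt_min !subr_gt0 hM hL.
  have d0 : 0 < d by rewrite divr_gt0.
  have dS : d * (muM + muL + 1) = Num.min (xM - muM) (xL - muL).
    by rewrite divfK // gt_eqF.
  exists (1 + d); first by lra.
  have le1 : d * (muM + muL + 1) <= xM - muM by rewrite dS ge_min lexx.
  have le2 : d * (muM + muL + 1) <= xL - muL by rewrite dS ge_min lexx orbT.
  by split; nra.
have step n t : M <= t <= L -> 0 < X n -> t * Y n <= X n ->
    0 < X n.+1 /\ q * t * Y n.+1 <= X n.+1.
  move=> /andP[Mt tL] Xn tY.
  have [a [b [a0 b0 aM aL Yn]]] := stepY n.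
  have Xn' := stepX n.
  have t0 : 0 < t by exact: lt_le_trans Mt.
  (* Barycentric coordinate of [t] between [M] and [L]. *)
  pose r := (t - M) / (L - M).
  have r0 : 0 <= r by rewrite divr_ge0 ?subr_ge0 // ltW.
  have r1 : r <= 1 by rewrite ler_pdivrMr ?subr_gt0 // mul1r lerD2r.
  have tr : t = (1 - r) * M + r * L.
    have : r * (L - M) = t - M by rewrite divfK // subr_eq0 gt_eqF.
    by lra.
  (* Convexity of the inverse, with the defect [r (1 - r) (L - M)^2 / (L M)] made explicit after
     multiplying by [t]. *)
  have num : (1 - r) * xM + r * xL <= m - t^-1 * A.
    suff : t^-1 <= (1 - r) * M^-1 + r * L^-1 by rewrite /xM /xL; nra.
    rewrite -[t^-1]mul1r ler_pdivrMr // tr.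
    have -> : ((1 - r) / M + r / L) * ((1 - r) * M + r * L) =
      1 + r * (1 - r) * ((L - M) ^+ 2 / (L * M)) by field; rewrite !gt_eqF.
    rewrite lerDl; apply: mulr_ge0; first by rewrite mulr_ge0 // subr_ge0.
    by rewrite divr_ge0 ?sqr_ge0 // ltW // mulr_gt0.
  have xr0 : 0 < (1 - r) * xM + r * xL by nra.
  have lb : ((1 - r) * xM + r * xL) * X n <= X n.+1.
    apply: (@le_trans _ _ ((m - t^-1 * A) * X n)); first by rewrite ler_wpM2r // ltW.
    apply: le_trans Xn'; rewrite mulrBl lerB //.
    by rewrite [t^-1 * A]mulrC -mulrA ler_wpM2l // ler_pdivlMl.
  split; first by apply: lt_le_trans lb; exact: mulr_gt0.
  apply: le_trans lb; apply: (@le_trans _ _ (q * (a + t * b) * X n)).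
    rewrite -!mulrA ler_pM2l; last by lra.
    apply: (@le_trans _ _ (t * (a * Y n + b * X n))); first by rewrite ler_pM2l.
    have := ler_wpM2l a0 tY; nra.
  rewrite ler_pM2r // tr.
  (* The upper rate [a + t b] is affine in [t], so its bounds at [M] and [L] interpolate. *)
  have -> : q * (a + ((1 - r) * M + r * L) * b) =
     (1 - r) * (q * (a + M * b)) + r * (q * (a + L * b)) by ring.
  have q0 : 0 <= q by lra.
  have hM' := le_trans (ler_wpM2l q0 aM) qM.
  have hL' := le_trans (ler_wpM2l q0 aL) qL.
  by rewrite lerD // ler_wpM2l ?subr_ge0.
(* The slope is capped at [L] because [step] only treats slopes up to [L]; once there, a factor
   [q > 1] keeps it at least [L]. *)
have slopes n : 0 < X n /\ Num.min (q ^+ n * M) L * Y n <= X n.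
  elim: n => [|n [Xn slope]].
    rewrite expr0 mul1r (min_idPl (ltW ML)); split; last exact: ltW.
    by apply: le_lt_trans X0; rewrite mulr_ge0 // ltW.
  set t := Num.min _ _ in slope.
  have tML : M <= t <= L.
    rewrite /t le_min (ltW ML) ge_min lexx orbT !andbT.
    by rewrite ler_peMl ?exprn_ege1 // ltW.
  have [Xn1 slope1] := step n t tML Xn slope; split=> //.
  apply: le_trans slope1; rewrite ler_wpM2r //.
  have [qt|qt] := leP (q ^+ n * M) L.
    by rewrite /t (min_idPl qt) ge_min exprS mulrA lexx.
  rewrite /t (min_idPr (ltW qt)) ge_min; apply/orP; right.
  by rewrite ler_peMl ?ltW.
(* From [n0] on, [q ^+ n * M] exceeds [L] and the cap is active. *)
have [n0 hn0] := exp_unbounded (L / M) q1.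
have atL n : (n0 <= n)%N -> L * Y n <= X n.
  move=> n0n; have [_] := slopes n; rewrite (min_idPr _) //.
  rewrite -ler_pdivrMr //; apply: le_trans (ltW hn0) _.
  by rewrite ler_weXn2l // ltW.
(* With slope at least [L], [A * Y n] is at most [L^-1 * A * X n], so each step multiplies [X] by at
   least [xL > 1], against the bound [C]. *)
have grow k : xL ^+ k * X n0 <= X (n0 + k)%N.
  elim: k => [|k IHk]; first by rewrite expr0 mul1r addn0.
  rewrite addnS exprS -mulrA; apply: (@le_trans _ _ (xL * X (n0 + k)%N)).
    by rewrite ler_pM2l //; lra.
  apply: le_trans (stepX _); rewrite /xL mulrBl lerB //.
  rewrite [L^-1 * A]mulrC -mulrA ler_wpM2l // ler_pdivlMl //.
  by apply: atL; exact: leq_addr.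
have [Xn0 _] := slopes n0.
have [k] := exp_unbounded (C / X n0) hL1.
rewrite ltr_pdivrMr // => kC.
by have := le_lt_trans (le_trans (grow k) (andP (XC _)).2) kC; rewrite ltxx.
Qed.

End Growth.

(** * The Lipschitz bound for the graph of the center-stable set *)

Unset Implicit Arguments.

Theorem theorem3p5 (R : realType) (c u s k : nat) (Rad L M : R)
  (F : 'rV[R]_(c + u + s) -> 'rV[R]_(c + u + s))
  (w : 'rV[R]_c -> 'rV[R]_s -> 'rV[R]_u) :
  (0 < c)%N -> (0 < u)%N -> (0 < s)%N -> (1 <= k)%N ->
  0 < Rad -> Rad < 4^-1 ->
  4 * Rad < L -> L < 1 ->
  (* F is a lift of f : D -> Lambda x R^u x R^s (Lambda = (R/Z)^c) *)
  (forall z d, latt d -> latt (F (z + d) - F z)) ->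
  (* f is C^(k+1) on (a neighbourhood of) D *)
  (exists U, open U /\ inD Rad `<=` U /\ forall i, Cm k.+1 U (fun z => F z 0 i)) ->
  covering Rad F L ->
  rate_conditions k Rad F L ->
  backward_cone Rad F L ->
  (* w is w^cs : W^cs is the graph of w over Lambda x closed ball_s(Rad) *)
  (forall z, Wcs Rad F z <-> (enorm (yc z) <= Rad /\ xc z = w (lam z) (yc z))) ->
  0 < M -> M < L ->
  let xi := inf [set mint Rad F z (@Ix c u s) (@Ix c u s) | z in inD Rad]
            - M^-1 * supD Rad F (fun A => opn A (@Ix c u s) (@Ily c u s)) in
  let mu := supD Rad F (fun A => opn A (@Ily c u s) (@Ily c u s) + M * opn A (@Ily c u s) (@Ix c u s)) in
  1 < xi / mu ->
  forall (l1 l2 : 'rV[R]_c) (y1 y2 : 'rV[R]_s),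
    enorm (l1 - l2) <= 2^-1 -> enorm y1 <= Rad -> enorm y2 <= Rad ->
    enorm (w l1 y1 - w l2 y2) <= M * enorm (row_mx (l1 - l2) (y1 - y2)).
Proof.
move=> _ _ _ _ Rad0 _ RadL _ Flatt [U [oU [DU FC]]] _.
move=> [_ [[_ xiL1] [csL _]]] _ wcs M0 ML xi mu ximu l1 l2 y1 y2 _ y1R y2R.
have FC1 := Cm_C1 oU FC.
have [B B0 FB] := jac_bounded FC1 DU (ltW Rad0) Flatt.
have L0 : 0 < L by exact: lt_trans ML.
pose z l y : 'rV[R]_(c + u + s) := row_mx (row_mx l (w l y)) y.
have zW l y : enorm y <= Rad -> Wcs Rad F (z l y).
  by move=> yR; apply/wcs; rewrite /yc /xc /lam /z !row_mxKr !row_mxKl row_mxKr.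
have := zW l1 y1 y1R; have := zW l2 y2 y2R.
set z1 := z l1 y1; set z2 := z l2 y2 => z2W z1W.
(* Difference of the lifted orbits, without reduction modulo the lattice. *)
pose dz n := iter n F z1 - iter n F z2.
pose m := inf [set mint Rad F p (@Ix c u s) (@Ix c u s) | p in inD Rad].
pose A := supD Rad F (fun A => opn A (@Ix c u s) (@Ily c u s)).
pose X n := enorm (Defs.proj (@Ix c u s) (dz n)).
pose Y n := enorm (Defs.proj (@Ily c u s) (dz n)).
have D0 : inD Rad z1 := z1W 0%N.
have mu0 : 0 <= mu.
  apply: le_trans (opnD_le_supD B0 FB _ _ _ _ (ltW M0) D0).
  by rewrite addr_ge0 ?mulr_ge0 ?opn_ge0 // ltW.
have muxi : mu < xi.
  (* Division by 0 yields 0, so [1 < xi / mu] excludes [mu = 0]. *)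
  have mugt0 : 0 < mu.
    by rewrite lt_def mu0 andbT; apply: contraTneq ximu => ->; rewrite invr0 mulr0 ltr10.
  by move: ximu; rewrite ltr_pdivlMr // mul1r.
have : X 0%N <= M * Y 0%N.
  (* Here [xM] is [xi] and [xL] is [xi_u1P]. The bound [Rad + Rad] holds because both orbits remain
     in D. *)
  apply: (@slope_bound R X Y m A mu (mu_cs1 Rad F L) M L (Rad + Rad)) => //.
  - exact: le_trans (opn_ge0 _ _ _) (opn_le_supD B0 FB _ _ D0).
  - move=> n; rewrite enorm_ge0 /= /X -enorm_xc.
    have -> : xc (dz n) = xc (iter n F z1) - xc (iter n F z2).
      by apply/rowP => i; rewrite !mxE.
    apply: le_trans (enormD _ _) _; rewrite enormN.
    by apply: lerD; [case: (z1W n)|case: (z2W n)].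
  - by move=> n; exact: enorm_ge0.
  - by move=> n; exact: expansion_x FC1 DU B0 FB _ _ (z1W n) (z2W n).
  - move=> n.
    have [a [b [a0 b0 ab h]]] := contraction_ly FC1 DU B0 FB (z1W n) (z2W n).
    by exists a, b; split=> //; apply: ab; exact: ltW.
rewrite /X /Y -enorm_xc -enorm_lamy.
have -> : xc (dz 0%N) = w l1 y1 - w l2 y2.
  by apply/rowP => i; rewrite /dz /= /z1 /z2 /z /xc !linearB /= !row_mxKl !row_mxKr.
have -> // : lamy (dz 0%N) = row_mx (l1 - l2) (y1 - y2).
by rewrite /dz /= /z1 /z2 /z /lamy /lam /yc !linearB /= !row_mxKl !row_mxKr.
Qed.
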